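(* Let $n\geq 4$ be an integer. There exists a positive formula $\psi_n(a,b)$ of the first-order language $\mathcal{L}$ with the two free variables $a,b$ such that for every $n$-dimensional projective space $\Pi$ and all lines $a,b$ of $\Pi$: $\psi_n(a,b)$ holds in the $\mathcal{L}$-structure of lines of $\Pi$ if and only if $a\sim b$ does not hold. In other words, in projective geometry of dimension $n \geq 4$, non-intersection of two lines is positively definable in terms of line-intersection.
   Context: $\mathcal{L}$ is the one-sorted first-order language with equality whose only non-logical symbol is a binary relation symbol $\sim$. For a projective space $\Pi$, the $\mathcal{L}$-structure of lines of $\Pi$ has as universe the set of all lines of $\Pi$, and $a\sim b$ is interpreted as ''$a$ and $b$ are different lines which have a point in common''. Thus $a\sim b$ fails exactly when $a=b$ or $a$ and $b$ have no common point. A formula of $\mathcal{L}$ is positive if it is built from atomic formulas ($x\sim y$ and $x=y$, with $x,y$ variables) using only $\wedge$, $\vee$, $\forall$, $\exists$ (no negation, no implication); the formula $a\sim a$ serves as an identically false formula. Dimension means projective dimension; the formula depends only on $n$, not on the space. *)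

(* Defs.v *)
From mathcomp Require Import all_boot all_classical.

Set Implicit Arguments.
Unset Strict Implicit.
Unset Printing Implicit Defensive.

Local Open Scope classical_set_scope.

(* Variables are named by natural numbers. *)
Inductive formula : Type :=
| Eq of nat & nat
| Sim of nat & nat
| Not of formula
| And of formula & formula
| Or of formula & formula
| Imp of formula & formula
| All of nat & formula
| Ex of nat & formula.

Fixpoint positive (f : formula) : bool :=
  match f with
  | Eq _ _ | Sim _ _ => true
  | And f g | Or f g => positive f && positive g
  | All _ f | Ex _ f => positive f
  | Not _ | Imp _ _ => false
  end.

Fixpoint free_in (x : nat) (f : formula) : bool :=
  match f with
  | Eq y z | Sim y z => (x == y) || (x == z)
  | Not f => free_in x f
  | And f g | Or f g | Imp f g => free_in x f || free_in x g
  | All y f | Ex y f => (x != y) && free_in x f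
  end.

Definition update (U : Type) (e : nat -> U) (x : nat) (u : U) : nat -> U :=
  fun y => if y == x then u else e y.

Fixpoint sat (U : Type) (R : U -> U -> Prop) (e : nat -> U) (f : formula) :
    Prop :=
  match f with
  | Eq x y => e x = e y
  | Sim x y => R (e x) (e y)
  | Not f => ~ sat R e f
  | And f g => sat R e f /\ sat R e g
  | Or f g => sat R e f \/ sat R e g
  | Imp f g => sat R e f -> sat R e g
  | All x f => forall u : U, sat R (update e x u) f
  | Ex x f => exists u : U, sat R (update e x u) f
  end.

(* The Veblen-Young axioms. Lines are abstract objects, but by [join_unique]
   and [three_points] a line is determined by the set of its points. *)
Record projective_space : Type := ProjectiveSpace {
  point : Type;
  line : Type;
  on : line -> set point;
  join_exists : forall p q : point, p <> q ->
    exists l : line, on l p /\ on l q;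
  join_unique : forall (p q : point) (l m : line), p <> q ->
    on l p -> on l q -> on m p -> on m q -> l = m;
  (* if ab meets cd, then ac meets bd *)
  veblen : forall (a b c d : point) (ab cd ac bd : line),
    a <> b -> a <> c -> a <> d -> b <> c -> b <> d -> c <> d ->
    on ab a -> on ab b -> on cd c -> on cd d ->
    on ac a -> on ac c -> on bd b -> on bd d ->
    (exists p : point, on ab p /\ on cd p) ->
    exists q : point, on ac q /\ on bd q;
  three_points : forall l : line, exists p q r : point,
    [/\ p <> q, p <> r & q <> r] /\ [/\ on l p, on l q & on l r]
}.

Section Dimension.
Variable Pi : projective_space.

Definition subspace (S : set (point Pi)) : Prop :=
  forall (p q : point Pi) (l : line Pi),
    p <> q -> S p -> S q -> on l p -> on l q -> on l `<=` S.

Definition span (X : set (point Pi)) : set (point Pi) := smallest subspace X.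

Definition independent (k : nat) (p : 'I_k -> point Pi) : Prop :=
  forall i : 'I_k, ~ span (p @` [set j | j <> i]) (p i).

(* Projective dimension: a basis of an n-dimensional space has n + 1 points. *)
Definition has_dim (n : nat) : Prop :=
  exists p : 'I_n.+1 -> point Pi, independent p /\ span (range p) = setT.

End Dimension.

Definition meets (Pi : projective_space) (a b : line Pi) : Prop :=
  a <> b /\ exists p : point Pi, on a p /\ on b p.

(* Main.v *)
From mathcomp Require Import all_boot all_classical zify.
Require Import Defs.

Set Implicit Arguments.
Unset Strict Implicit.
Unset Printing Implicit Defensive.

Local Open Scope classical_set_scope.

(** A positive formula that describes concurrency gives access to points, and
    spanning then gives skewness.

    Three lines that meet pairwise are concurrent or form a triangle.  If they
    pass through a common point O, then every line x is reached by a line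
    touching all three: join O to a point of x.  If they form a triangle, then
    a line touching all three lies in the plane of the triangle, and when
    n >= 4 some line x misses this plane.  So the positive condition: for
    every x there is a y touching the three lines and x, separates the two
    cases ([concurrentP]).  This is where n >= 4 is essential: in dimension 3
    a duality exchanges points and planes.

    A point is now coded by two lines that meet there, and incidence is
    positive.  Distinctness of points is positive too: P <> Q holds exactly
    when every line that does not contain both carries a point R such that
    some line through P and R differs from some line through Q and R
    ([distinctP]).  Hence membership in
    the subspace generated by finitely many points is positive, by adding one
    point at a time and forming joins.

    Two different lines a and b are skew if and only if two points of a, two
    points of b and n - 3 further points can generate the whole space
    ([skew_extends], [generators_skew]): skew lines give four independent
    points, to be completed to a basis, whereas the four points lie in a plane
    as soon as a and b share a point, so that the n + 1 points generate at
    most what n points generate.  The assertion that everything is generated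
    is positive because it can be made for all lines: each of them contains
    two distinct generated points ([gen_fullP]). *)

(** * Subspaces generated by finitely many points *)

Section Span.
Variable Pi : projective_space.
Implicit Types (P Q R X Y Z q : point Pi) (l m : line Pi).
Implicit Types (S T : set (point Pi)) (s t : seq (point Pi)).

(** The cone over S with apex q; it is written with the clause Y <> q, which
    prevents l from being an arbitrary line through q. *)
Definition join q S : set (point Pi) :=
  [set X | [\/ X = q, S X |
     exists Y l, [/\ S Y, Y <> q & [/\ on l Y, on l q & on l X]]]].

Fixpoint gen s : set (point Pi) :=
  if s is q :: s' then join q (gen s') else set0.

Fixpoint indep s : Prop :=
  if s is q :: s' then ~ gen s' q /\ indep s' else True.

Lemma sub_join q S : S `<=` join q S.
Proof. by move=> X SX; apply: Or32. Qed.

Lemma join_apex q S : join q S q.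
Proof. exact: Or31. Qed.

Lemma join_min q S T : subspace T -> T q -> S `<=` T -> join q S `<=` T.
Proof.
move=> subT Tq ST X [->//|/ST//|[Y [l [/ST TY Yq [lY lq lX]]]]].
exact: (subT Y q l).
Qed.

(** Given a triangle q, x, y and a line l that meets the sides qx and qy in
    X and Y, every line from q to a point Z of l meets the third side m.  The
    Veblen axiom is used twice: first l meets m in a point U, and then the
    lines ZU = l and qx (or qy, when U = x) meet, so that qZ meets m. *)
Lemma pasch (q x y X Y Z : point Pi) (l m k1 k2 : line Pi) :
  q <> x -> q <> y -> x <> y -> X <> Y ->
  on k1 q -> on k1 x -> on k1 X -> on k2 q -> on k2 y -> on k2 Y ->
  on m x -> on m y -> on l X -> on l Y -> on l Z ->
  X <> q -> Y <> q -> Z <> q -> ~ on m q ->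
  exists k W, [/\ on k q, on k Z, on k W & on m W].
Proof.
move=> qx qy xy XY k1q k1x k1X k2q k2y k2Y mx my lX lY lZ Xq Yq Zq mq.
have k12 : k1 <> k2.
  move=> e; rewrite e in k1x k1q; apply: mq.
  by rewrite -(join_unique xy k1x k2y mx my).
have [k [kq kZ]] := join_exists (not_eq_sym Zq).
suff [W [kW mW]] : exists W, on k W /\ on m W by exists k, W.
have [U [mU lU]] : exists U, on m U /\ on l U.
  have [xX|xX] := pselect (x = X); first by exists x; rewrite {2}xX.
  have [yY|yY] := pselect (y = Y); first by exists y; rewrite {2}yY.
  have xY : x <> Y.
    by move=> e; apply: k12; apply: (join_unique qx) => //; rewrite e.
  have Xy : X <> y.
    by move=> e; apply: k12; apply: (join_unique qy) => //; rewrite -e.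
  by apply: (@veblen Pi x X y Y k1 k2) => //; exists q.
have [ZU|ZU] := pselect (Z = U); first by exists Z; rewrite {2}ZU.
have qU : q <> U by move=> e; apply: mq; rewrite e.
have [xZ|xZ] := pselect (x = Z); first by exists x; rewrite {1}xZ.
have [yZ|yZ] := pselect (y = Z); first by exists y; rewrite {1}yZ.
have [xU|xU] := pselect (x = U).
  apply: (@veblen Pi q y Z U k2 l) => //; [exact: not_eq_sym| |by exists Y].
  by rewrite -xU; exact: not_eq_sym.
apply: (@veblen Pi q x Z U k1 l) => //; [exact: not_eq_sym|by exists X].
Qed.

Lemma join_subspace q S : subspace S -> subspace (join q S).
Proof.
move=> subS X Y l XY jX jY lX lY Z lZ.
have [Sq|Sq] := pselect (S q).
  have jS : join q S `<=` S by apply: join_min.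
  by apply: sub_join; apply: (subS X Y l) => //; apply: jS.
have cone U : join q S U -> U <> q ->
    exists w k, [/\ S w, w <> q & [/\ on k w, on k q & on k U]].
  move=> [->//|SU Tq|//]; have [k [kU kq]] := join_exists Tq.
  by exists U, k.
have incone w k U : S w -> on k w -> on k q -> on k U -> join q S U.
  move=> Sw kw kq kU; apply: Or33; exists w, k; split => // e.
  by apply: Sq; rewrite -e.
have [Zq|Zq] := pselect (Z = q); first by rewrite Zq; exact: join_apex.
have [lq|lq] := pselect (on l q).
  suff [w [Sw lw]] : exists w, S w /\ on l w by apply: (incone w l).
  have [Xq|Xq] := pselect (X = q).
    have Yq : Y <> q by move=> e; apply: XY; rewrite Xq e.
    have [w [k [Sw wq [kw kq kY]]]] := cone _ jY Yq.
    by exists w; split=> //; rewrite (join_unique Yq lY lq kY kq).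
  have [w [k [Sw wq [kw kq kX]]]] := cone _ jX Xq.
  by exists w; split=> //; rewrite (join_unique Xq lX lq kX kq).
have Xq : X <> q by move=> e; apply: lq; rewrite -e.
have Yq : Y <> q by move=> e; apply: lq; rewrite -e.
have [x [k1 [Sx xq [k1x k1q k1X]]]] := cone _ jX Xq.
have [y [k2 [Sy yq [k2y k2q k2Y]]]] := cone _ jY Yq.
have [xy|xy] := pselect (x = y).
  case: lq; have e : k1 = k2 by apply: (join_unique xq) => //; rewrite xy.
  by rewrite (join_unique XY lX lY k1X) // e.
have [m [mx my]] := join_exists xy.
have mS : on m `<=` S by apply: (subS x y).
have mq : ~ on m q by move=> /mS.
have [k [W [kq kZ kW mW]]] : exists k W, [/\ on k q, on k Z, on k W & on m W].
  by apply: (@pasch q x y X Y Z l m k1 k2) => //; exact: not_eq_sym.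
by apply: (incone W k) => //; apply: mS.
Qed.

Lemma gen_subspace s : subspace (gen s).
Proof. by elim: s => [? ? ? ? []|q s IH] /=; exact: join_subspace. Qed.

Lemma line_subspace l : subspace (on l).
Proof.
by move=> X Y m XY lX lY mX mY Z; rewrite (join_unique XY mX mY lX lY).
Qed.

Lemma gen_catr s t : gen t `<=` gen (s ++ t).
Proof. by elim: s => [//|q s IH] X /IH; exact: sub_join. Qed.

Lemma gen_cat_min s t T :
  subspace T -> gen s `<=` T -> gen t `<=` T -> gen (s ++ t) `<=` T.
Proof.
move=> subT + tT; elim: s => [//|q s IH] /= sT; apply: join_min => //.
  by apply/sT/join_apex.
by apply: IH => X sX; apply/sT/sub_join.
Qed.

Lemma gen_catl s t : gen s `<=` gen (s ++ t).
Proof.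
elim: s => [//|q s IH] /=; apply: join_min (join_apex _ _) _.
  exact: (@gen_subspace (q :: s ++ t)).
by move=> X /IH; exact: sub_join.
Qed.

Lemma join_exchange q S X : ~ S X -> join q S X -> join X S q.
Proof.
move=> SX [->|//|[Y [l [SY Yq [lY lq lX]]]]]; first exact: join_apex.
by apply: Or33; exists Y, l; split=> // e; apply: SX; rewrite -e.
Qed.

(** Descending along s, either X is already generated after the first point of
    s is dropped, and that point is kept, or X depends on it and takes its
    place by [join_exchange]. *)
Lemma gen_exchange s t X : ~ gen t X -> gen (s ++ t) X ->
  exists s', (size s').+1 = size s /\ gen (s ++ t) `<=` gen (X :: s' ++ t).
Proof.
move=> tX; elim: s => [//|y s IH] /=.
have [stX _|stX jX] := pselect (gen (s ++ t) X).
  have [s' [<- sub]] := IH stX; exists (y :: s'); split=> //.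
  have sub' := @gen_subspace [:: X, y & s' ++ t].
  apply: join_min => //; first by apply: sub_join; exact: join_apex.
  move=> Z /sub; apply: join_min => //; first exact: join_apex.
  by move=> U gU; do 2 apply: sub_join.
exists s; split=> //; apply: join_min; last exact: sub_join.
  exact: (@gen_subspace (X :: s ++ t)).
exact: join_exchange.
Qed.

(** Steinitz: the points of t replace generators one for one. *)
Lemma steinitz s t : gen s = setT -> indep t ->
  exists s', size s' + size t = size s /\ gen (s' ++ t) = setT.
Proof.
move=> sT; elim: t => [_|X t IH /= [tX /IH [s1 [sz1 g1]]]].
  by exists s; rewrite cats0 addn0.
have [|s2 [sz2 sub]] := @gen_exchange s1 t X tX; first by rewrite g1.
rewrite g1 in sub.
exists s2; split; first by rewrite addnS -sz1 -sz2 addSn.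
apply/seteqP; split=> // Z _; have := sub Z I.
apply: join_min; first exact: gen_subspace.
  by apply: gen_catr; exact: join_apex.
apply: gen_cat_min; [exact: gen_subspace|exact: gen_catl|].
by move=> U tU; apply: gen_catr; exact: sub_join.
Qed.

End Span.

(** * Bases and dimension *)

Section Dimension.
Variables (Pi : projective_space) (n : nat).
Hypothesis dimPi : has_dim Pi n.
Implicit Types (P Q R X Y Z q : point Pi) (l m x y : line Pi).
Implicit Types (S T : set (point Pi)) (s t : seq (point Pi)).

Lemma span_subspace (S : set (point Pi)) : subspace (span S).
Proof.
move=> X Y l XY SX SY lX lY Z lZ A [subA SA].
by apply: (subA X Y l) => //; [apply: SX|apply: SY].
Qed.

Lemma gen_map_sub_span (I : eqType) (p : I -> point Pi) (r : seq I)
    (D : set I) :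
  {in r, forall i, D i} -> gen (map p r) `<=` span (p @` D).
Proof.
elim: r => [_ X []|i r IH rD]; apply: (@join_min _ (p i)) => /=.
- exact: span_subspace.
- by apply: sub_gen_smallest; apply: (imageP p); apply: rD; rewrite mem_head.
- by apply: IH => j jr; apply: rD; rewrite inE jr orbT.
Qed.

Lemma has_dim_basis :
  exists s, [/\ size s = n.+1, indep s & gen s = setT].
Proof.
have [p [indp spanp]] := dimPi.
exists (map p (enum 'I_n.+1)); split.
- by rewrite size_map size_enum_ord.
- elim: (enum _) (enum_uniq 'I_n.+1) => [//|i r IH] /= /andP[ir /IH ur].
  split=> // /(gen_map_sub_span (D := [set j | j <> i])) gi.
  by apply: (indp i); apply: gi => j jr /= ji; rewrite -ji jr in ir.
- apply/seteqP; split=> // X _.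
  have : span (range p) X by rewrite spanp.
  apply: smallest_sub; first exact: gen_subspace.
  move=> _ [i _ <-]; have : i \in enum 'I_n.+1 by rewrite mem_enum.
  elim: (enum _) => [//|j r IH]; rewrite inE => /orP[/eqP <-|/IH].
    exact: join_apex.
  exact: sub_join.
Qed.

Lemma size_generators s : gen s = setT -> n < size s.
Proof.
have [b [szb indb _]] := has_dim_basis.
by move=> /steinitz/(_ indb)[s' [<- _]]; rewrite szb leq_addl.
Qed.

Lemma notin_gen s : size s <= n -> exists X, ~ gen s X.
Proof.
move=> ssz; apply/not_existsP => h.
have /size_generators : gen s = setT.
  by apply/seteqP; split=> // X _; exact: contrapT.
by rewrite ltnNge ssz.
Qed.

Lemma extend_to_generators s : indep s ->
  exists s', size s' + size s = n.+1 /\ gen (s' ++ s) = setT.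
Proof.
have [b [<- _ genb]] := has_dim_basis; exact: steinitz.
Qed.

(** When C is outside gen s and D is outside gen (C :: s), a common point of
    the line CD and gen s would put D into gen (C :: s). *)
Lemma line_missing s : (size s).+2 <= n.+1 ->
  exists l, forall X, on l X -> ~ gen s X.
Proof.
move=> ssz; have [C sC] := notin_gen (ltnW ssz).
have [D sD] := @notin_gen (C :: s) ssz.
have CD : D <> C by move=> e; apply: sD; rewrite e; exact: join_apex.
have [l [lD lC]] := join_exists CD.
exists l => X lX sX; apply: sD; apply: Or33; exists X, l; split=> // e.
by apply: sC; rewrite -e.
Qed.

End Dimension.

(** * Concurrency, distinctness and skewness by positive conditions *)

Section Incidence.
Variable Pi : projective_space.
Implicit Types (P Q R X Y Z : point Pi) (l m p q r x y : line Pi).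

Lemma other_point l P : exists Q, on l Q /\ Q <> P.
Proof.
have [A [B [_ [[AB _ _] [lA lB _]]]]] := three_points l.
have [e|] := pselect (A = P); last by exists A.
by exists B; split=> // e'; apply: AB; rewrite e.
Qed.

Lemma point_off l m : l <> m -> exists P, on l P /\ ~ on m P.
Proof.
move=> lm; apply/not_existsP => h.
have lsub P : on l P -> on m P.
  by move=> lP; apply: contrapT => mP; apply: (h P).
have [A [B [_ [[AB _ _] [lA lB _]]]]] := three_points l.
by apply: lm; apply: (join_unique AB) => //; exact: lsub.
Qed.

Definition near l m := l = m \/ meets l m.

Lemma nearP l m : near l m <-> exists P, on l P /\ on m P.
Proof.
split=> [[<-|[]//]|].
  by have [A [_ [_ [_ [lA _ _]]]]] := three_points l; exists A.
by move=> lm; have [|] := pselect (l = m); [left|right].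
Qed.

(** The pair of lines l, m is a code of the point P. *)
Definition crossing l m P := [/\ l <> m, on l P & on m P].

Lemma meetsP l m : meets l m <-> exists P, crossing l m P.
Proof. by split=> [[lm [P []]]|[P []]]; [exists P|split=> //; exists P]. Qed.

(** For a triangle PQR, a line that touches the three sides has two points in
    the plane PQR, hence lies in it, and a line x missing this plane is out of
    reach.  A plane being generated by three points, [line_missing] provides x
    as soon as n >= 4. *)
Lemma concurrentP n p q r : 4 <= n -> has_dim Pi n ->
  meets p q -> meets q r -> meets p r ->
  (forall x, exists y, [/\ near y p, near y q, near y r & near y x]) <->
  exists P, [/\ on p P, on q P & on r P].
Proof.
move=> n4 dimPi [pq [P [pP qP]]] [qr [Q [qQ rQ]]] [pr [R [pR rR]]].
split; last first.
  move=> [O [pO qO rO]] x.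
  have [X [xX XO]] := other_point x O.
  have [y [yX yO]] := join_exists XO.
  by exists y; split; apply/nearP; [exists O|exists O|exists O|exists X].
move=> h; apply: contrapT => nc.
have rP : ~ on r P by move=> rP; apply: nc; exists P.
have [x xE] : exists x, forall X, on x X -> ~ gen [:: P; Q; R] X.
  by apply: (line_missing dimPi).
have subE := @gen_subspace Pi [:: P; Q; R].
have EP : gen [:: P; Q; R] P by exact: join_apex.
have EQ : gen [:: P; Q; R] Q by apply: sub_join; exact: join_apex.
have ER : gen [:: P; Q; R] R by do 2 apply: sub_join; exact: join_apex.
have PQ : P <> Q by move=> e; apply: rP; rewrite e.
have PR : P <> R by move=> e; apply: rP; rewrite e.
have QR : Q <> R.
  by move=> e; apply: nc; exists Q; split=> //; rewrite e.
have [y [/nearP[A [yA pA]] /nearP[B [yB qB]]]] := h x.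
move=> /nearP[C [yC rC]] /nearP[X [yX xX]].
have EA : gen [:: P; Q; R] A by apply: (subE P R p).
have EB : gen [:: P; Q; R] B by apply: (subE P Q q).
have EC : gen [:: P; Q; R] C by apply: (subE Q R r).
apply: (xE X xX).
(* A, B and C cannot all coincide, so that y has two points in the plane. *)
have [AB|AB] := pselect (A = B); last exact: (subE A B y).
apply: (subE A C y) => // AC; apply: nc; exists A; split=> //.
  by rewrite AB.
by rewrite AC.
Qed.

(** If P = Q, the lines u and v through P and R coincide unless R = P; a line
    x that avoids P therefore refutes the condition. *)
Lemma distinctP n P Q : 1 < n -> has_dim Pi n ->
  P <> Q <-> forall x, (on x P /\ on x Q) \/
    exists R, on x R /\ exists u v,
      [/\ on u P, on u R, on v Q & on v R] /\ meets u v.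
Proof.
move=> n1 dimPi; split=> [PQ x|h e].
  have [l [lP lQ]] := join_exists PQ.
  have [->|xl] := pselect (x = l); first by left.
  right; have [R [xR lR]] := point_off xl; exists R; split=> //.
  have PR : P <> R by move=> e; apply: lR; rewrite -e.
  have QR : Q <> R by move=> e; apply: lR; rewrite -e.
  have [u [uP uR]] := join_exists PR.
  have [v [vQ vR]] := join_exists QR.
  exists u, v; do 2 split=> //; last by exists R.
  move=> e; apply: lR; rewrite (join_unique PQ lP lQ uP) //.
  by rewrite e.
have [x xP] : exists x, forall X, on x X -> ~ gen [:: P] X.
  exact: (line_missing dimPi).
have notP X : on x X -> P <> X.
  by move=> /xP gX eX; apply: gX; rewrite -eX; exact: join_apex.
case: (h x) => [[/notP//]|[R [/notP PR [u [v [[uP uR vQ vR] [uv _]]]]]]].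
by apply: uv; apply: (join_unique PR) => //; rewrite e.
Qed.

Lemma two_lines_through n P : 1 < n -> has_dim Pi n ->
  exists u v, crossing u v P.
Proof.
move=> n1 dimPi.
have [C PC] : exists X, ~ gen [:: P] X.
  by apply: (notin_gen dimPi); apply: ltnW.
have [D PD] : exists X, ~ gen [:: C; P] X by exact: (notin_gen dimPi).
have PC' : P <> C by move=> e; apply: PC; rewrite -e; exact: join_apex.
have PD' : P <> D.
  by move=> e; apply: PD; rewrite -e; apply: sub_join; exact: join_apex.
have [u [uP uC]] := join_exists PC'.
have [v [vP vD]] := join_exists PD'.
exists u, v; split=> // e; apply: PD.
apply: (@gen_subspace _ [:: C; P] C P u) => //.
- exact: not_eq_sym.
- exact: join_apex.
- by apply: sub_join; exact: join_apex.
- by rewrite e.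
Qed.

(** Quantifying over lines avoids a universal quantifier over points, which
    would have to be relativised to meeting pairs of lines by an implication.
    Two points are needed on each line, since a hyperplane also has a point on
    each line. *)
Lemma gen_fullP n s : 1 < n -> has_dim Pi n ->
  (forall x, exists X, on x X /\ exists Y, on x Y /\
     [/\ gen s X, gen s Y & X <> Y]) <-> gen s = setT.
Proof.
move=> n1 dimPi; split=> [h|-> x]; last first.
  have [A [B [_ [[AB _ _] [lA lB _]]]]] := three_points x.
  by exists A; split=> //; exists B.
apply/seteqP; split=> // Z _.
have [x [_ [_ xZ _]]] := two_lines_through Z n1 dimPi.
have [X [xX [Y [xY [gX gY XY]]]]] := h x.
exact: (@gen_subspace _ s X Y x).
Qed.

(** Two points on each of two skew lines are independent and extend to a
    basis. *)
Lemma skew_extends n a b : 3 <= n -> has_dim Pi n ->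
  a <> b -> ~ meets a b -> exists P P' Q Q' s,
    [/\ on a P, on a P', on b Q, on b Q' &
        size s = n - 3 /\ gen [:: P, P', Q, Q' & s] = setT].
Proof.
move=> n3 dimPi ab nab.
have skew X : on a X -> on b X -> False.
  by move=> aX bX; apply: nab; split=> //; exists X.
have [P [P' [_ [[PP' _ _] [aP aP' _]]]]] := three_points a.
have [Q [Q' [_ [[QQ' _ _] [bQ bQ' _]]]]] := three_points b.
have ga X : gen [:: P'; P] X -> on a X.
  have suba := @line_subspace Pi a.
  by apply: join_min => //; apply: join_min.
have indP : indep [:: Q'; Q; P'; P].
  split; last split; last split; last by split.
  - move=> [e|/ga aQ'|[Y [l [/ga aY YQ [lY lQ lQ']]]]].
    + exact: QQ'.
    + exact: (skew Q').
    + by apply: (skew Y) => //; rewrite (join_unique QQ' bQ bQ' lQ lQ').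
  - by move=> /ga aQ; exact: (skew Q).
  - by move=> [e|//|[? [? [[]]]]]; exact: PP'.
have [s [szs gens]] := extend_to_generators dimPi indP.
exists P, P', Q, Q', s; split=> //; split; first by move: szs => /=; lia.
apply/seteqP; split=> // X _.
have : gen (s ++ [:: Q'; Q; P'; P]) X by rewrite gens.
have subG := @gen_subspace Pi [:: P, P', Q, Q' & s].
apply: gen_cat_min => //; first by move=> Y sY; do 4 apply: sub_join.
apply: join_min => //; first by do 3 apply: sub_join; exact: join_apex.
apply: join_min => //; first by do 2 apply: sub_join; exact: join_apex.
apply: join_min => //; first by apply: sub_join; exact: join_apex.
by apply: join_min => //; exact: join_apex.
Qed.

(** With a common point R and further points A of a and B of b, the three
    points A, B, R generate both lines, so that n points would generate the
    space. *)
Lemma generators_skew n a b P P' Q Q' s : 3 <= n -> has_dim Pi n ->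
  on a P -> on a P' -> on b Q -> on b Q' -> size s = n - 3 ->
  gen [:: P, P', Q, Q' & s] = setT -> ~ meets a b.
Proof.
move=> n3 dimPi aP aP' bQ bQ' szs gens [_ [R [aR bR]]].
have [A [aA AR]] := other_point a R.
have [B [bB BR]] := other_point b R.
have subG := @gen_subspace Pi [:: A, B, R & s].
have GR : gen [:: A, B, R & s] R by do 2 apply: sub_join; exact: join_apex.
have Ga X : on a X -> gen [:: A, B, R & s] X.
  by apply: (subG A R a) => //; exact: join_apex.
have Gb X : on b X -> gen [:: A, B, R & s] X.
  by apply: (subG B R b) => //; apply: sub_join; exact: join_apex.
have : gen [:: A, B, R & s] = setT.
  apply/seteqP; split=> // X _.
  have : gen [:: P, P', Q, Q' & s] X by rewrite gens.
  do 4 (apply: join_min; [done|by [apply: Ga|apply: Gb]|]).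
  by move=> Y sY; do 3 apply: sub_join.
by move/(size_generators dimPi) => /=; rewrite szs; lia.
Qed.

End Incidence.

(** * Quantifiers over fresh variables *)

(** The formulas for relations between lines and points bind only variables
    above those that name their arguments, so that an assignment for the body
    agrees with the outer one below the bound variable. *)
Definition agree (U : Type) (k : nat) (e e' : nat -> U) : Prop :=
  forall i, i < k -> e' i = e i.

Section Quantifiers.
Variables (U : Type) (R : U -> U -> Prop).
Implicit Types (e : nat -> U) (f g : formula).

Lemma agree_trans j k e1 e2 e3 :
  j <= k -> agree j e1 e2 -> agree k e2 e3 -> agree j e1 e3.
Proof. by move=> jk e12 e23 i ij; rewrite e23 ?e12 //; apply: leq_trans jk. Qed.

Lemma agree_update k e u : agree k e (update e k u).
Proof. by move=> i ik; rewrite /update ltn_eqF. Qed.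

Lemma update_at k e u : update e k u k = u.
Proof. by rewrite /update eqxx. Qed.

Lemma sat_And e f g : sat R e (And f g) = (sat R e f /\ sat R e g).
Proof. by []. Qed.

Lemma sat_Or e f g : sat R e (Or f g) = (sat R e f \/ sat R e g).
Proof. by []. Qed.

Lemma sat_Sim e x y : sat R e (Sim x y) = R (e x) (e y).
Proof. by []. Qed.

Lemma sat_Ex k e f (Q : U -> Prop) :
  (forall e', agree k e e' -> sat R e' f = Q (e' k)) ->
  sat R e (Ex k f) = (exists u, Q u).
Proof.
move=> fQ; rewrite -[LHS]/(exists u, sat R (update e k u) f).
congr ex; apply/funext => u; rewrite fQ ?update_at //; exact: agree_update.
Qed.

Lemma sat_All k e f (Q : U -> Prop) :
  (forall e', agree k e e' -> sat R e' f = Q (e' k)) ->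
  sat R e (All k f) = (forall u, Q u).
Proof.
move=> fQ; rewrite -[LHS]/(forall u, sat R (update e k u) f) propeqE.
have eQ u : sat R (update e k u) f = Q u.
  by rewrite fQ ?update_at //; exact: agree_update.
by split=> h u; [rewrite -eQ|rewrite eQ].
Qed.

End Quantifiers.

(** * The positive formulas *)

Definition Near (y p : nat) : formula := Or (Eq y p) (Sim y p).

Definition Concurrent (p q r : nat) : formula :=
  let x := (p + q + r).+1 in
  And (And (Sim p q) (And (Sim q r) (Sim p r)))
    (All x (Ex x.+1 (And (And (Near x.+1 p) (Near x.+1 q))
                         (And (Near x.+1 r) (Near x.+1 x))))).

(** From here on a point is named by a variable i, and is coded by the lines
    that are the values of i and i.+1. *)
Definition On (i l : nat) : formula :=
  Or (Or (Eq l i) (Eq l i.+1)) (Concurrent i i.+1 l).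

Definition SamePoint (i j : nat) : formula := And (On i j) (On i j.+1).

Definition ExP (i : nat) (f : formula) : formula :=
  Ex i (Ex i.+1 (And (Sim i i.+1) f)).

Definition Distinct (i j : nat) : formula :=
  let x := (i + j).+2 in let r := x.+1 in let u := x.+3 in let v := u.+1 in
  All x (Or (And (On i x) (On j x))
    (ExP r (And (On r x)
       (Ex u (Ex v (And (And (And (On i u) (On r u)) (And (On j v) (On r v)))
                        (Sim u v))))))).

Fixpoint InGen (s : seq nat) (i : nat) : formula :=
  if s is j :: s' then
    let y := (i + j + sumn s').+2 in let l := y.+2 in
    Or (SamePoint i j) (Or (InGen s' i)
      (ExP y (And (InGen s' y) (And (Distinct y j)
         (Ex l (And (On y l) (And (On j l) (On i l))))))))
  (* false, as no line meets itself: the empty list generates no point *)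
  else Sim i i.

Definition Generates (s : seq nat) : formula :=
  let x := (sumn s).+2 in let y := x.+1 in let z := y.+2 in
  All x (ExP y (And (On y x) (ExP z (And (On z x)
     (And (InGen s y) (And (InGen s z) (Distinct y z))))))).

(** * Meaning of the formulas *)

Section Meaning.
Variables (Pi : projective_space) (n : nat).
Hypotheses (n_ge4 : 4 <= n) (dimPi : has_dim Pi n).
Implicit Types (e : nat -> line Pi) (P Q : point Pi) (f g : formula).

Local Notation holds := (sat (@meets Pi)).
Local Notation codes e i P := (crossing (e i) (e i.+1) P).

Let n_gt1 : 1 < n. Proof. exact: ltn_trans n_ge4. Qed.

Lemma crossing_uniq (l m : line Pi) P Q :
  crossing l m P -> crossing l m Q -> P = Q.
Proof.
move=> [lm lP mP] [_ lQ mQ]; apply: contrapT => PQ.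
by apply: lm; apply: (join_unique PQ).
Qed.

(** Every point has a code, since two lines pass through it. *)
Lemma sat_ExP i e f (Q : point Pi -> Prop) :
  (forall e' P, agree i e e' -> codes e' i P -> holds e' f = Q P) ->
  holds e (ExP i f) = (exists P, Q P).
Proof.
move=> fQ.
have ag u v : agree i e (update (update e i u) i.+1 v).
  exact: agree_trans (leqnSn i) (@agree_update _ _ _ _) (@agree_update _ _ _ _).
have upi u v : update (update e i u) i.+1 v i = u.
  by rewrite agree_update // update_at.
rewrite -[LHS]/(exists u v, meets (update (update e i u) i.+1 v i)
  (update (update e i u) i.+1 v i.+1) /\
  holds (update (update e i u) i.+1 v) f) propeqE.
split=> [[u [v [/meetsP[P cP]]]]|[P QP]].
  by rewrite (fQ _ P (ag u v) cP); exists P.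
have [u [v cP]] := two_lines_through P n_gt1 dimPi.
exists u, v; have cP' : codes (update (update e i u) i.+1 v) i P.
  by rewrite upi update_at.
by split; [apply/meetsP; exists P|rewrite (fQ _ P)].
Qed.

Lemma sat_Near e y p : holds e (Near y p) = near (e y) (e p).
Proof. by []. Qed.

Lemma sat_Concurrent e p q r : holds e (Concurrent p q r) =
  ([/\ meets (e p) (e q), meets (e q) (e r) & meets (e p) (e r)] /\
    exists P, [/\ on (e p) P, on (e q) P & on (e r) P]).
Proof.
rewrite /Concurrent; have : [/\ p < (p + q + r).+1, q < (p + q + r).+1
  & r < (p + q + r).+1] by split; lia.
move: (p + q + r).+1 => x [px qx rx].
rewrite !sat_And (sat_All (Q := fun u => exists y,
  [/\ near y (e p), near y (e q), near y (e r) & near y u])); last first.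
  move=> e1 e01; apply: sat_Ex => e2 e12.
  rewrite !sat_And !sat_Near (e12 p (ltnW px)) (e12 q (ltnW qx)).
  rewrite (e12 r (ltnW rx)) (e12 x (ltnSn x)) (e01 p px) (e01 q qx) (e01 r rx).
  by rewrite propeqE; split=> [[[? ?] [? ?]]|[]].
rewrite propeqE; split=> [[[pq [qr pr]] h]|[[pq qr pr] h]].
  by split=> //; apply/(concurrentP n_ge4 dimPi).
by split=> //; apply/(concurrentP n_ge4 dimPi).
Qed.

Lemma sat_On e i l P : codes e i P -> holds e (On i l) = on (e l) P.
Proof.
move=> cP; have [ij iP jP] := cP.
rewrite !sat_Or sat_Concurrent propeqE; split.
  move=> [[->|->]//|[_ [Q [iQ jQ lQ]]]].
  by have <- : Q = P by apply: crossing_uniq cP.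
move=> lP.
have [li|li] := pselect (e l = e i); first by left; left.
have [lj|lj] := pselect (e l = e i.+1); first by left; right.
right; split; last by exists P.
by split; (split; last by exists P) => //; exact: not_eq_sym.
Qed.

Lemma sat_SamePoint e i j P Q : codes e i P -> codes e j Q ->
  holds e (SamePoint i j) = (P = Q).
Proof.
move=> cP cQ; have [jj jQ jQ'] := cQ.
rewrite sat_And !(sat_On _ cP) propeqE; split=> [[? ?]|->//].
exact: crossing_uniq cQ.
Qed.

Lemma codes_agree k e e' i P :
  agree k e e' -> i.+1 < k -> codes e i P -> codes e' i P.
Proof. by move=> ee' ik; rewrite !ee' // ltnW. Qed.

Lemma sat_Distinct e i j P Q : codes e i P -> codes e j Q ->
  holds e (Distinct i j) = (P <> Q).
Proof.
rewrite /Distinct; have : i.+1 < (i + j).+2 /\ j.+1 < (i + j).+2 by split; lia.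
move: (i + j).+2 => x [ix jx] cP cQ.
rewrite (propext (distinctP P Q n_gt1 dimPi)); apply: sat_All => e1 e01.
have cP1 := codes_agree e01 ix cP; have cQ1 := codes_agree e01 jx cQ.
rewrite sat_Or sat_And (sat_On _ cP1) (sat_On _ cQ1); congr (_ \/ _).
apply: sat_ExP => e2 R e12 cR.
have cP2 := codes_agree e12 (ltnW ix) cP1.
have cQ2 := codes_agree e12 (ltnW jx) cQ1.
rewrite sat_And (sat_On _ cR) e12 //; congr (_ /\ _).
apply: sat_Ex => e3 e23; apply: sat_Ex => e4 e34.
have e24 : agree x.+3 e2 e4 by apply: agree_trans e34.
have cP4 : codes e4 i P by apply: (codes_agree e24 _ cP2); lia.
have cQ4 : codes e4 j Q by apply: (codes_agree e24 _ cQ2); lia.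
have cR4 : codes e4 x.+1 R by apply: (codes_agree e24 _ cR); lia.
rewrite !sat_And sat_Sim !(sat_On _ cP4) !(sat_On _ cQ4) !(sat_On _ cR4) e34 //.
by rewrite propeqE; split=> [[[[? ?] [? ?]] ?]|[[]]].
Qed.

Lemma sat_InGen e i s (pt : nat -> point Pi) P :
  {in s, forall j, codes e j (pt j)} -> codes e i P ->
  holds e (InGen s i) = gen (map pt s) P.
Proof.
elim: s e i P => [|j s IH] e i P cs cP.
  by rewrite propeqE; split=> // -[].
rewrite [InGen _ _]/=; have : [/\ i.+1 < (i + j + sumn s).+2,
    j.+1 < (i + j + sumn s).+2 & {in s, forall h, h.+1 < (i + j + sumn s).+2}].
  split; [lia|lia|]; elim: (s) => [//|a s' IHs] h.
  by rewrite inE => /orP[/eqP->|/IHs] /=; lia.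
move: (i + j + sumn s).+2 => y [iy jy sy].
have cj : codes e j (pt j) by apply: cs; rewrite mem_head.
have cs' : {in s, forall h, codes e h (pt h)}.
  by move=> h hs; apply: cs; rewrite inE hs orbT.
rewrite 2!sat_Or (sat_SamePoint cP cj) (IH _ _ _ cs' cP).
rewrite (sat_ExP (Q := fun Y => gen (map pt s) Y /\ (Y <> pt j /\
   exists l, [/\ on l Y, on l (pt j) & on l P]))).
  rewrite propeqE; split.
    move=> [->|[|[Y [sY [Yj [l [lY lj lP]]]]]]]; [exact: Or31|exact: Or32|].
    by apply: Or33; exists Y, l.
  move=> [->|?|[Y [l [sY Yj [lY lj lP]]]]]; [by left|by right; left|].
  by right; right; exists Y; do 2 split=> //; exists l.
move=> e1 Y e01 cY.
have cs1 : {in s, forall h, codes e1 h (pt h)}.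
  by move=> h hs; apply: (codes_agree e01); [exact: sy|exact: cs'].
have cj1 := codes_agree e01 jy cj; have cP1 := codes_agree e01 iy cP.
rewrite !sat_And (IH _ _ _ cs1 cY) (sat_Distinct cY cj1); do 2 congr (_ /\ _).
apply: sat_Ex => e2 e12.
have cY2 : codes e2 y Y by apply: (codes_agree e12 _ cY).
have cj2 : codes e2 j (pt j) by apply: (codes_agree e12 _ cj1); lia.
have cP2 : codes e2 i P by apply: (codes_agree e12 _ cP1); lia.
rewrite !sat_And (sat_On _ cY2) (sat_On _ cj2) (sat_On _ cP2).
by rewrite propeqE; split=> [[? []]|[]].
Qed.

Lemma sat_Generates e s (pt : nat -> point Pi) :
  {in s, forall j, codes e j (pt j)} ->
  holds e (Generates s) = (gen (map pt s) = setT).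
Proof.
rewrite /Generates; have : {in s, forall h, h.+1 < (sumn s).+2}.
  elim: (s) => [//|a s' IHs] h.
  by rewrite inE => /orP[/eqP->|/IHs] /=; lia.
move: (sumn s).+2 => x sx cs.
rewrite -(propext (gen_fullP (map pt s) n_gt1 dimPi)).
apply: sat_All => e1 e01; apply: sat_ExP => e2 Y e12 cY.
rewrite sat_And (sat_On _ cY) e12 //; congr (_ /\ _).
apply: sat_ExP => e3 Z e23 cZ.
have e03 : agree x e e3.
  by apply: agree_trans e23; [lia|apply: agree_trans e12].
have cs3 : {in s, forall h, codes e3 h (pt h)}.
  by move=> h hs; apply: (codes_agree e03); [exact: sx|exact: cs].
have cY3 : codes e3 x.+1 Y by apply: (codes_agree e23 _ cY); lia.
rewrite !sat_And (sat_On _ cZ) (sat_InGen cs3 cY3) (sat_InGen cs3 cZ).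
rewrite (sat_Distinct cY3 cZ) e23 ?e12 //; last lia.
by rewrite propeqE; split=> [[? [? []]]|[? []]].
Qed.

End Meaning.

(** * Closing the formula and checking its free variables *)

Lemma positive_InGen s i : positive (InGen s i).
Proof. by elim: s i => [//|j s IH] i /=; rewrite !IH. Qed.

Fixpoint var_bound (f : formula) : nat :=
  match f with
  | Eq x y | Sim x y => maxn x y
  | Not g => var_bound g
  | And g h | Or g h | Imp g h => maxn (var_bound g) (var_bound h)
  | All x g | Ex x g => maxn x (var_bound g)
  end.

Lemma free_in_bound x f : free_in x f -> x <= var_bound f.
Proof.
elim: f => [y z|y z|g IH|g IHg h IHh|g IHg h IHh|g IHg h IHh|y g IH|y g IH] /=.
- by case/orP => /eqP ->; lia.
- by case/orP => /eqP ->; lia.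
- exact: IH.
- by case/orP => [/IHg|/IHh]; lia.
- by case/orP => [/IHg|/IHh]; lia.
- by case/orP => [/IHg|/IHh]; lia.
- by case/andP => _ /IH; lia.
- by case/andP => _ /IH; lia.
Qed.

Definition Exs (r : seq nat) (f : formula) : formula := foldr Ex f r.

Lemma free_in_Exs x r f : free_in x (Exs r f) = (x \notin r) && free_in x f.
Proof. by elim: r => [//|k r IH] /=; rewrite IH inE negb_or andbA. Qed.

Lemma positive_Exs r f : positive (Exs r f) = positive f.
Proof. by elim: r. Qed.

Lemma sat_Exs (U : Type) (R : U -> U -> Prop) e r f :
  sat R e (Exs r f) <->
  exists e', (forall i, i \notin r -> e' i = e i) /\ sat R e' f.
Proof.
elim: r e => [|k r IH] e.
  split=> [fe|[e' [ee' fe']]]; first by exists e.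
  by have <- : e' = e by apply/funext => i; exact: ee'.
split=> [[u /IH[e' [ee' fe']]]|[e' [ee' fe']]].
  exists e'; split=> // i; rewrite inE negb_or => /andP[ik ir].
  by rewrite ee' // /update (negbTE ik).
exists (e' k); apply/IH; exists e'; split=> // i ir; rewrite /update.
by have [->//|ik] := eqVneq i k; apply: ee'; rewrite inE negb_or ik.
Qed.

(** The variables in r code points. *)
Definition Points (r : seq nat) (f : formula) : formula :=
  foldr (fun i => And (Sim i i.+1)) f r.

Lemma positive_Points r f : positive (Points r f) = positive f.
Proof. by elim: r. Qed.

Lemma sat_Points (U : Type) (R : U -> U -> Prop) e r f :
  sat R e (Points r f) <->
  {in r, forall i, R (e i) (e i.+1)} /\ sat R e f.
Proof.
elim: r => [|k r IH]; first by split=> [|[]].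
split=> [[rk /IH[rr fe]]|[rr fe]].
  by split=> // i; rewrite inE => /orP[/eqP->|/rr].
split; first by apply: rr; rewrite mem_head.
by apply/IH; split=> // i ir; apply: rr; rewrite inE ir orbT.
Qed.

(** * The formula for non-intersection *)

(** The variables 2, 4, 6 and so on, with their successors, code the n + 1
    generating points; the variables 0 and 1 are the two given lines. *)
Definition point_vars (n : nat) : seq nat := mkseq (fun i => i.*2.+2) n.+1.

Definition Spanning (n : nat) : formula :=
  Points (point_vars n)
    (And (And (And (On 2 0) (On 4 0)) (And (On 6 1) (On 8 1)))
         (Generates (point_vars n))).

(** These cover the codes of all the points and every free variable of
    [Spanning n] other than 0 and 1; quantifying over them at once closes the
    formula. *)
Definition bound_vars (n : nat) : seq nat :=
  iota 2 (maxn n.+1.*2 (var_bound (Spanning n))).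

Definition NotMeets (n : nat) : formula :=
  Or (Eq 0 1) (Exs (bound_vars n) (Spanning n)).

Lemma positive_NotMeets n : positive (NotMeets n).
Proof.
by rewrite /NotMeets /= positive_Exs positive_Points /= !positive_InGen.
Qed.

Lemma free_in_NotMeets n x : free_in x (NotMeets n) <-> x = 0 \/ x = 1.
Proof.
rewrite /NotMeets /= free_in_Exs; split=> [|[]->//].
case/orP => [/orP[]/eqP|]; [by left|by right|].
by case/andP => + /free_in_bound; rewrite mem_iota; lia.
Qed.

Lemma point_vars_bound n j : j \in point_vars n ->
  j \in bound_vars n /\ j.+1 \in bound_vars n.
Proof. by case/mapP => i; rewrite !mem_iota => ? ->; split; lia. Qed.

Lemma sat_NotMeets (Pi : projective_space) n (e : nat -> line Pi) :
  4 <= n -> has_dim Pi n ->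
  sat (@meets Pi) e (NotMeets n) <-> ~ meets (e 0) (e 1).
Proof.
move=> n4 dimPi; have n3 : 3 <= n by exact: ltnW.
have pv : exists r, point_vars n = [:: 2, 4, 6, 8 & r] /\ size r = n - 3.
  exists (drop 4 (point_vars n)); rewrite size_drop size_mkseq subSS.
  by split=> //; case: n n4 {dimPi n3} => [|[|[|[|m]]]].
have bv01 i : i < 2 -> i \notin bound_vars n by rewrite mem_iota; lia.
rewrite /NotMeets sat_Or; split.
  move=> [ab [ne _]|/sat_Exs[e' [ee' /sat_Points[ptse]]]]; first exact: ne.
  have /choice[pt cpt] : forall j, exists X : point Pi,
      j \in point_vars n -> crossing (e' j) (e' j.+1) X.
    move=> j; have [/ptse/meetsP[X cX]|jn] := boolP (j \in point_vars n).
      by exists X.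
    by have [X _] := three_points (e 0); exists X.
  have [r [pvE szr]] := pv.
  rewrite !sat_And (sat_Generates n4 dimPi cpt).
  rewrite !(sat_On n4 dimPi _ (cpt _ _)) ?pvE ?inE //= !ee' ?bv01 //.
  move=> [[[aP aP'] [bQ bQ']] gens].
  by apply: (generators_skew n3 dimPi aP aP' bQ bQ' _ gens); rewrite size_map.
move=> ab; have [eab|neab] := pselect (e 0 = e 1); first by left.
right; have [P [P' [Q [Q' [s [aP aP' bQ bQ' [szs gens]]]]]]] :=
  skew_extends n3 dimPi neab ab.
have /choice[uv cuv] : forall X : point Pi, exists w, crossing w.1 w.2 X.
  have n2 : 1 < n by exact: ltnW.
  move=> X; have [u [v c]] := two_lines_through X n2 dimPi.
  by exists (u, v).
set ps := [:: P, P', Q, Q' & s] in gens.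
pose pt j := nth P ps j./2.-1.
pose e' i := if i \in bound_vars n then
  (if odd i then (uv (pt i)).2 else (uv (pt i)).1) else e i.
have ee' i : i \notin bound_vars n -> e' i = e i by rewrite /e' => /negbTE ->.
have cpt : {in point_vars n, forall j, crossing (e' j) (e' j.+1) (pt j)}.
  move=> j jn; have [jb jb1] := point_vars_bound jn.
  case/mapP: jn => i _ ij; rewrite /e' jb jb1 /= ij /= odd_double /=.
  by rewrite /pt /= uphalf_double doubleK; exact: cuv.
have ptE : map pt (point_vars n) = ps.
  have szps : size ps = n.+1 by rewrite /= szs; lia.
  rewrite -map_comp -[RHS](mkseq_nth P) szps.
  by apply: eq_map => i; rewrite /pt /= doubleK.
apply/sat_Exs; exists e'; split=> //; apply/sat_Points; split.
  by move=> j jn; apply/meetsP; exists (pt j); exact: cpt.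
have [r [pvE _]] := pv.
rewrite !sat_And (sat_Generates n4 dimPi cpt) ptE.
by rewrite !(sat_On n4 dimPi _ (cpt _ _)) ?pvE ?inE //= !ee' ?bv01.
Qed.

(* The free variables a, b of the formula are the variables 0 and 1. *)
Theorem mainTheorem1 (n : nat) (hn : 4 <= n) :
  exists psi : formula,
    [/\ positive psi,
        forall x : nat, free_in x psi <-> x = 0 \/ x = 1
      & forall Pi : projective_space, has_dim Pi n ->
        forall (a b : line Pi) (e : nat -> line Pi), e 0 = a -> e 1 = b ->
          (sat (@meets Pi) e psi <-> ~ meets a b)].
Proof.
exists (NotMeets n); split; [exact: positive_NotMeets|exact: free_in_NotMeets|].
by move=> Pi dimPi a b e <- <-; exact: sat_NotMeets.
Qed.
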